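(* Let an equilibrium $\mathbf{W}(\rho) := \rho\big(\mathbf{H}(\rho)-\mathbf{h}(\rho)\big)$ be given and assume that the function $q$ is two times differentiable in a small neighbourhood of $\mathbf{H}(\rho)$. Consider, for a parameter $\varepsilon>0$, the relaxed model for the unknowns $(\rho,z,w)(t,x)$, $$ \begin{cases} \partial_t \rho + \partial_x\big(\rho\, v(\rho,z,w)\big)=0,\\[2pt] \partial_t z+\partial_x\Big(\dfrac{z^2}{\rho}-z\,q(h)\Big)=0,\\[2pt] \partial_t w+\partial_x\big(w\,v(\rho,z,w)\big)=-\dfrac{\mathbf{W}(\rho)-w}{\varepsilon}, \end{cases} $$ where $v(\rho,z,w)=\dfrac{z}{\rho}-q(h)$ and $h$ is determined by $w=\rho\big(h-\mathbf{h}(\rho)\big)$. Then the first-order correction to the local equilibrium approximation of this model (the one obtained from the Chapman-Enskog expansion $w=\mathbf{W}(\rho)+\varepsilon w^{(1)}+\mathcal{O}(\varepsilon^2)$) reads $$ \begin{cases} \partial_t \rho + \partial_x\Big(\rho\, v\big(\rho,z,\mathbf{W}(\rho)\big)\Big)=\varepsilon\,\partial_x\Big(\rho\,\mu(\rho)\,\partial_x v\big(\rho,z,\mathbf{W}(\rho)\big)\Big)+\mathcal{O}(\varepsilon^2),\\[2pt] \partial_t z+\partial_x\Big(\dfrac{z^2}{\rho}-z\,q\big(\mathbf{H}(\rho)\big)\Big)=\varepsilon\,\partial_x\Big(z\,\mu(\rho)\,\partial_x v\big(\rho,z,\mathbf{W}(\rho)\big)\Big)+\mathcal{O}(\varepsilon^2),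 \end{cases} $$ with $$\mu(\rho):=\rho\,q'\big(\mathbf{H}(\rho)\big)\big(\mathbf{h}'(\rho)-\mathbf{H}'(\rho)\big).$$ In particular, the diffusion coefficients $\rho\,\mu(\rho)$ and $z\,\mu(\rho)$ are positive provided that $\mathbf{H}'(\rho)<\mathbf{h}'(\rho)$.
   Context: Here $\rho=\rho(t,x)>0$ is a traffic density, $v$ the mean velocity, $h$ a driver-dependent scalar quantity (hesitation). The functions $\mathbf{h}$, $\mathbf{H}$ (of $\rho$) and $q$ (of $h$) are given sufficiently smooth real functions of one real variable with $q'>0$ and $\mathbf{h}'>0$. The bold symbol $\mathbf{h}(\cdot)$ denotes a given function, whereas $h$ is an unknown. The variable $z$ stands for $z=\rho\,(v+q(h))$ and is assumed positive. Note $v\big(\rho,z,\mathbf{W}(\rho)\big)=\frac{z}{\rho}-q\big(\mathbf{H}(\rho)\big)$. Chapman-Enskog expansion and first-order correction: one considers smooth solutions $(\rho,z,w)$ depending on $\varepsilon$ for which $w=\mathbf{W}(\rho)+\varepsilon w^{(1)}+\mathcal{O}(\varepsilon^2)$ as $\varepsilon\to0$, where $\rho$, $z$, $w^{(1)}$ and their derivatives are $\mathcal{O}(1)$. The coefficient $w^{(1)}$ is determined up to $\mathcal{O}(\varepsilon)$ by the third equation. As usual in such formal expansions, $\mathcal{O}(\varepsilon^k)$ terms remain $\mathcal{O}(\varepsilon^k)$ after differentiation in $t$ and $x$. The first-order correction to the local equilibrium approximation is the system for $(\rho,z)$ obtained by inserting this expansion into the first two equations and collecting terms up to $\mathcal{O}(\varepsilon^2)$.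 *)

(* Defs.v *)
From Stdlib Require Import Reals Lra.
From Coquelicot Require Import Coquelicot.
Open Scope R_scope.

Definition dt (f : R -> R -> R) (t x : R) : R := Derive (fun s => f s x) t.
Definition dx (f : R -> R -> R) (t x : R) : R := Derive (fun y => f t y) x.

Definition class_C (D : R -> Prop) (n : nat) (f : R -> R) : Prop :=
  forall r, D r ->
    (forall k, (k <= n)%nat -> ex_derive_n f k r) /\ continuous (Derive_n f n) r.

(* [bigO Om n k f]: the family of fields [f e t x] is O(e^k) as e -> 0+,
   uniformly on Om, together with all its partial derivatives in t and x up to
   order n, which exist on Om for e small.  The usual convention that O-terms
   may be differentiated is thus built into the symbol.  Since Om is an
   arbitrary open set, uniformity on Om covers local uniformity. *)
Fixpoint bigO (Om : R * R -> Prop) (n k : nat) (f : R -> R -> R -> R) : Prop :=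
  (exists C : R,
      at_right 0 (fun e => forall t x, Om (t, x) -> Rabs (f e t x) <= C * e ^ k)) /\
  match n with
  | O => True
  | S m =>
      at_right 0 (fun e => forall t x, Om (t, x) ->
        ex_derive (fun s => f e s x) t /\ ex_derive (fun y => f e t y) x) /\
      bigO Om m k (fun e => dt (f e)) /\
      bigO Om m k (fun e => dx (f e))
  end.

(* The solution h of w = rho * (h - hb rho); see [hesitationP]. *)
Definition hesitation (hb : R -> R) (rho w : R) : R := hb rho + w / rho.

Lemma hesitationP (hb : R -> R) (rho w h : R) :
  0 < rho -> (w = rho * (h - hb rho) <-> h = hesitation hb rho w).
Proof.
intros Hr; unfold hesitation; split; intros ->; field; lra.
Qed.

Definition velocity (q hb : R -> R) (rho z w : R) : R :=
  z / rho - q (hesitation hb rho w).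

Definition Weq (hb H : R -> R) (rho : R) : R := rho * (H rho - hb rho).

Definition mu (q hb H : R -> R) (rho : R) : R :=
  rho * Derive q (H rho) * (Derive hb rho - Derive H rho).

Definition relaxed_model (q hb H : R -> R) (Om : R * R -> Prop) (e : R)
    (rho z w : R -> R -> R) : Prop :=
  forall t x, Om (t, x) ->
    dt rho t x
      + dx (fun t x => rho t x * velocity q hb (rho t x) (z t x) (w t x)) t x = 0 /\
    dt z t x
      + dx (fun t x => z t x ^ 2 / rho t x
                       - z t x * q (hesitation hb (rho t x) (w t x))) t x = 0 /\
    dt w t x
      + dx (fun t x => w t x * velocity q hb (rho t x) (z t x) (w t x)) t x
      = - ((Weq hb H (rho t x) - w t x) / e).

(* Solutions of the relaxed model, for e small, that have a Chapman-Enskog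
   expansion w = W(rho) + e w1 + O(e^2) with N derivatives under control.
   D is the set of admissible densities.  The O(1) density must not degenerate
   as e -> 0 (otherwise w1 / rho would not be O(1)): it stays in a compact
   subinterval of D. *)
Record chapman_enskog (q hb H : R -> R) (D : R -> Prop) (Om : R * R -> Prop)
    (N : nat) (rho z w w1 : R -> R -> R -> R) : Prop := {
  ce_model : at_right 0 (fun e => relaxed_model q hb H Om e (rho e) (z e) (w e));
  ce_rho_range : exists a b : R,
    (forall r, a <= r <= b -> D r) /\
    at_right 0 (fun e => forall t x, Om (t, x) -> a <= rho e t x <= b);
  ce_z_pos : at_right 0 (fun e => forall t x, Om (t, x) -> 0 < z e t x);
  ce_rho : bigO Om N 0 rho;
  ce_z : bigO Om N 0 z;
  ce_w1 : bigO Om N 0 w1;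
  ce_expansion :
    bigO Om N 2 (fun e t x => w e t x - (Weq hb H (rho e t x) + e * w1 e t x))
}.

(* Main.v *)
Require Import Defs.
From Stdlib Require Import Reals Ranalysis5 Lra Lia.
From Coquelicot Require Import Coquelicot.
Open Scope R_scope.

(** Write [V] for the relaxed velocity, [v] for the equilibrium one, and
    [E = w - W(rho)], so that [E = e w1 + O(e^2)].

    Inserting the density equation and [W'] into the relaxation equation, all
    terms with [V dx rho] cancel and what is left is
      [w1 = (W - rho W') dx v + O(e) = rho^2 (hb' - H') dx v + O(e)],
    because the transport of [E], the difference [v - V] and the remainder of
    the expansion divided by [e] are all [O(e)] ([bigO_first_corrector]).
    On the other side, the hesitation is [H(rho) + E / rho], so a Taylor expansion
    of [q] at [H(rho)] gives [v - V = q'(H) E / rho + O(e^2)]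
    ([slip_expansion]).  Together,
      [v - V = e mu dx v + O(e^2)]  ([bigO_slip_minus_diffusion]).
    Both conservation laws have the form [dt g + dx (g V) = 0], with [g = rho]
    and [g = z]; hence each residual is the [x]-derivative of
    [g (v - V - e mu dx v)], and so [O(e^2)] ([bigO_residual]).

    These estimates have to hold together with their derivatives.  The
    bookkeeping rests on an algebra of [bigO]: sums, products, inverses,
    smooth functions of a field, and the increments and Taylor remainders of a
    smooth function.  Each rule is an induction on the number of derivatives:
    it is enough to bound the field itself, and to write its two first partial
    derivatives as combinations of fields that the rule, one derivative lower,
    already covers.  All derivatives are taken along one variable at a time, by
    the one-variable chain and product rules.  One derivative is spent on
    [dx v] and one on the final flux, whence the [n + 2] derivatives of the
    data; the Taylor remainder with [n + 1] derivatives takes [n + 3]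
    derivatives of [q]. *)

(** * The algebra of uniform O-terms *)

Definition eventually_on (Om : R * R -> Prop) (P : R -> R -> R -> Prop) : Prop :=
  at_right 0 (fun e => forall t x, Om (t, x) -> P e t x).

Definition bounded_by (Om : R * R -> Prop) (k : nat) (f : R -> R -> R -> R) :=
  exists C : R, eventually_on Om (fun e t x => Rabs (f e t x) <= C * e ^ k).

Lemma at_right_0_lt (d : R) : 0 < d -> at_right 0 (fun e => 0 < e < d).
Proof.
intros Hd; exists (mkposreal d Hd); intros e He He0.
split; [exact He0|].
unfold ball in He; simpl in He; unfold AbsRing_ball, abs, minus, plus, opp in He; simpl in He.
apply Rabs_def2 in He; lra.
Qed.

Section BigO.
Context (Om : R * R -> Prop) (Om_open : open Om).

(** The hypothesis is available at every point of the slice [e], as needed to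
    differentiate an identity that holds on the slice. *)
Lemma ev_imp_slice (P Q : R -> R -> R -> Prop) :
  (forall e, 0 < e < 1 -> (forall t x, Om (t, x) -> P e t x) ->
     forall t x, Om (t, x) -> Q e t x) ->
  eventually_on Om P -> eventually_on Om Q.
Proof.
unfold eventually_on; intros HPQ HP.
generalize (filter_and _ _ (at_right_0_lt 1 Rlt_0_1) HP); apply filter_imp.
intros e [He HPe]; apply HPQ; assumption.
Qed.

Lemma ev_imp (P Q : R -> R -> R -> Prop) :
  (forall e t x, 0 < e < 1 -> Om (t, x) -> P e t x -> Q e t x) ->
  eventually_on Om P -> eventually_on Om Q.
Proof. intros HPQ; apply ev_imp_slice; intros e He HP t x Htx; auto. Qed.

Lemma ev_forall (P : R -> R -> R -> Prop) :
  (forall e t x, 0 < e < 1 -> Om (t, x) -> P e t x) -> eventually_on Om P.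
Proof.
intros HP; unfold eventually_on; generalize (at_right_0_lt 1 Rlt_0_1).
apply filter_imp; auto.
Qed.

Lemma ev_and (P Q : R -> R -> R -> Prop) :
  eventually_on Om P -> eventually_on Om Q ->
  eventually_on Om (fun e t x => P e t x /\ Q e t x).
Proof.
unfold eventually_on; intros HP HQ; generalize (filter_and _ _ HP HQ); apply filter_imp.
intros e [HPe HQe] t x Htx; auto.
Qed.

Lemma Om_locally_t (t x : R) : Om (t, x) -> locally t (fun s => Om (s, x)).
Proof.
intros Htx; destruct (Om_open _ Htx) as [d Hd]; exists d; intros s Hs.
apply Hd; split; [exact Hs|apply ball_center].
Qed.

Lemma Om_locally_x (t x : R) : Om (t, x) -> locally x (fun y => Om (t, y)).
Proof.
intros Htx; destruct (Om_open _ Htx) as [d Hd]; exists d; intros y Hy.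
apply Hd; split; [apply ball_center|exact Hy].
Qed.

Lemma dx_ext (f g : R -> R -> R) (t x : R) :
  (forall t x, Om (t, x) -> f t x = g t x) -> Om (t, x) -> dx f t x = dx g t x.
Proof.
intros Hfg Htx; apply Derive_ext_loc.
generalize (Om_locally_x t x Htx); apply filter_imp; intros y; apply Hfg.
Qed.

Lemma bigO_bounded (m k : nat) f : bigO Om m k f -> bounded_by Om k f.
Proof. destruct m; intros [Hf _]; exact Hf. Qed.

Lemma bigO_partials (m k : nat) f : bigO Om (S m) k f ->
  eventually_on Om (fun e t x =>
    ex_derive (fun s => f e s x) t /\ ex_derive (fun y => f e t y) x).
Proof. intros [_ [Hf _]]; exact Hf. Qed.

Lemma bigO_dt (m k : nat) f :
  bigO Om (S m) k f -> bigO Om m k (fun e => dt (f e)).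
Proof. intros [_ [_ [Hf _]]]; exact Hf. Qed.

Lemma bigO_dx (m k : nat) f :
  bigO Om (S m) k f -> bigO Om m k (fun e => dx (f e)).
Proof. intros [_ [_ [_ Hf]]]; exact Hf. Qed.

(** Since [Om] is open, fields that agree on it have the same derivatives there. *)
Lemma bigO_ext (m k : nat) f g :
  eventually_on Om (fun e t x => f e t x = g e t x) -> bigO Om m k f -> bigO Om m k g.
Proof.
revert f g; induction m as [|m IH]; intros f g Hfg Hf.
- destruct Hf as [[C HC] _]; split; [exists C|exact I].
  generalize (ev_and _ _ Hfg HC); apply ev_imp; intros e t x _ _ [<- H]; exact H.
- destruct Hf as [[C HC] [Hp [Ht Hx]]]; split; [exists C|split; [|split]].
  + generalize (ev_and _ _ Hfg HC); apply ev_imp; intros e t x _ _ [<- H]; exact H.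
  + generalize (ev_and _ _ Hfg Hp); apply ev_imp_slice.
    intros e _ He t x Htx; destruct (He t x Htx) as [_ [H1 H2]]; split.
    * apply (ex_derive_ext_loc (fun s => f e s x)); [|exact H1].
      generalize (Om_locally_t t x Htx); apply filter_imp; intros s; apply He.
    * apply (ex_derive_ext_loc (fun y => f e t y)); [|exact H2].
      generalize (Om_locally_x t x Htx); apply filter_imp; intros y; apply He.
  + apply (IH (fun e => dt (f e))); [|exact Ht].
    revert Hfg; apply ev_imp_slice; intros e _ He t x Htx; apply Derive_ext_loc.
    generalize (Om_locally_t t x Htx); apply filter_imp; intros s; apply He.
  + apply (IH (fun e => dx (f e))); [|exact Hx].
    revert Hfg; apply ev_imp_slice; intros e _ He t x Htx; apply Derive_ext_loc.
    generalize (Om_locally_x t x Htx); apply filter_imp; intros y; apply He.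
Qed.

(** The induction step shared by the rules below: any expressions that
    are the partial derivatives on [Om] may stand for [dt f] and [dx f]. *)
Lemma bigO_S_intro (m k : nat) f ft fx :
  bounded_by Om k f ->
  eventually_on Om (fun e t x => is_derive (fun s => f e s x) t (ft e t x) /\
                      is_derive (fun y => f e t y) x (fx e t x)) ->
  bigO Om m k ft -> bigO Om m k fx -> bigO Om (S m) k f.
Proof.
intros Hb Hd Ht Hx; split; [exact Hb|split; [|split]].
- revert Hd; apply ev_imp; intros e t x _ _ [H1 H2]; split.
  + eexists; exact H1.
  + eexists; exact H2.
- apply (bigO_ext m k ft); [|exact Ht].
  revert Hd; apply ev_imp; intros e t x _ _ [H1 _].
  symmetry; apply is_derive_unique, H1.
- apply (bigO_ext m k fx); [|exact Hx].
  revert Hd; apply ev_imp; intros e t x _ _ [_ H2].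
  symmetry; apply is_derive_unique, H2.
Qed.

Lemma bigO_is_derive (m k : nat) f : bigO Om (S m) k f ->
  eventually_on Om (fun e t x => is_derive (fun s => f e s x) t (dt (f e) t x) /\
                      is_derive (fun y => f e t y) x (dx (f e) t x)).
Proof.
intros Hf; generalize (bigO_partials _ _ _ Hf); apply ev_imp.
intros e t x _ _ [H1 H2]; split; apply Derive_correct; assumption.
Qed.

Lemma bigO_pred (m k : nat) f : bigO Om (S m) k f -> bigO Om m k f.
Proof.
revert f; induction m as [|m IH]; intros f [Hb [Hp [Ht Hx]]].
- split; [exact Hb|exact I].
- split; [exact Hb|split; [exact Hp|split; apply IH; assumption]].
Qed.

Lemma bigO_le (m m' k : nat) f :
  (m <= m')%nat -> bigO Om m' k f -> bigO Om m k f.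
Proof. induction 1; auto using bigO_pred. Qed.

Lemma bigO_plus (m k : nat) f g : bigO Om m k f -> bigO Om m k g ->
  bigO Om m k (fun e t x => f e t x + g e t x).
Proof.
assert (Hb : forall f g, bounded_by Om k f -> bounded_by Om k g ->
  bounded_by Om k (fun e t x => f e t x + g e t x)).
{ intros f0 g0 [C HC] [C' HC']; exists (C + C').
  generalize (ev_and _ _ HC HC'); apply ev_imp; intros e t x _ _ [H1 H2].
  eapply Rle_trans; [apply Rabs_triang|]; lra. }
revert f g; induction m as [|m IH]; intros f g Hf Hg.
- split; [apply Hb; eapply bigO_bounded; eassumption|exact I].
- eapply bigO_S_intro.
  + apply Hb; eapply bigO_bounded; eassumption.
  + generalize (ev_and _ _ (bigO_is_derive _ _ _ Hf) (bigO_is_derive _ _ _ Hg)).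
    apply ev_imp; intros e t x _ _ [[Hft Hfx] [Hgt Hgx]]; split.
    * exact (is_derive_plus _ _ _ _ _ Hft Hgt).
    * exact (is_derive_plus _ _ _ _ _ Hfx Hgx).
  + exact (IH _ _ (bigO_dt _ _ _ Hf) (bigO_dt _ _ _ Hg)).
  + exact (IH _ _ (bigO_dx _ _ _ Hf) (bigO_dx _ _ _ Hg)).
Qed.

Lemma is_derive_Rmult (f g : R -> R) (x df dg : R) :
  is_derive f x df -> is_derive g x dg ->
  is_derive (fun y => f y * g y) x (df * g x + f x * dg).
Proof. intros Hf Hg; apply (is_derive_mult f g x df dg Hf Hg), Rmult_comm. Qed.

Lemma bigO_mult (m k l : nat) f g : bigO Om m k f -> bigO Om m l g ->
  bigO Om m (k + l) (fun e t x => f e t x * g e t x).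
Proof.
assert (Hb : forall f g, bounded_by Om k f -> bounded_by Om l g ->
  bounded_by Om (k + l) (fun e t x => f e t x * g e t x)).
{ intros f0 g0 [C HC] [C' HC']; exists (C * C').
  generalize (ev_and _ _ HC HC'); apply ev_imp; intros e t x _ _ [H1 H2].
  rewrite Rabs_mult, pow_add.
  replace (C * C' * (e ^ k * e ^ l)) with ((C * e ^ k) * (C' * e ^ l)) by ring.
  apply Rmult_le_compat; auto using Rabs_pos. }
revert f g; induction m as [|m IH]; intros f g Hf Hg.
- split; [apply Hb; eapply bigO_bounded; eassumption|exact I].
- eapply bigO_S_intro.
  + apply Hb; eapply bigO_bounded; eassumption.
  + generalize (ev_and _ _ (bigO_is_derive _ _ _ Hf) (bigO_is_derive _ _ _ Hg)).
    apply ev_imp; intros e t x _ _ [[Hft Hfx] [Hgt Hgx]]; split.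
    * exact (is_derive_Rmult _ _ _ _ _ Hft Hgt).
    * exact (is_derive_Rmult _ _ _ _ _ Hfx Hgx).
  + apply bigO_plus; apply IH; auto using bigO_pred, bigO_dt.
  + apply bigO_plus; apply IH; auto using bigO_pred, bigO_dx.
Qed.

(** A field depending on [e] alone has vanishing partial derivatives, so only
    its size matters. *)
Lemma bigO_cst (m k : nat) (c : R -> R) :
  bounded_by Om k (fun e _ _ => c e) -> bigO Om m k (fun e _ _ => c e).
Proof.
revert c; induction m as [|m IH]; intros c Hc; [split; [exact Hc|exact I]|].
assert (H0 : bigO Om m k (fun _ _ _ => 0)).
{ apply (IH (fun _ => 0)); exists 0; apply ev_forall.
  intros e t x _ _; rewrite Rabs_R0; lra. }
eapply bigO_S_intro; [exact Hc| |exact H0|exact H0].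
apply ev_forall; intros e t x _ _; split; apply @is_derive_const.
Qed.

Lemma bigO_real (m : nat) (c : R) : bigO Om m 0 (fun _ _ _ => c).
Proof.
apply (bigO_cst m 0 (fun _ => c)); exists (Rabs c); apply ev_forall.
intros e t x _ _; simpl; lra.
Qed.

Lemma bigO_e (m : nat) : bigO Om m 1 (fun e _ _ => e).
Proof.
apply (bigO_cst m 1 (fun e => e)); exists 1.
apply ev_forall; intros e t x He _.
rewrite Rabs_pos_eq; simpl; lra.
Qed.

Lemma bigO_opp (m k : nat) f :
  bigO Om m k f -> bigO Om m k (fun e t x => - f e t x).
Proof.
intros Hf; apply (bigO_ext _ _ (fun e t x => (-1) * f e t x)).
- apply ev_forall; intros e t x _ _; ring.
- exact (bigO_mult m 0 k _ _ (bigO_real m (-1)) Hf).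
Qed.

Lemma bigO_minus (m k : nat) f g : bigO Om m k f -> bigO Om m k g ->
  bigO Om m k (fun e t x => f e t x - g e t x).
Proof. intros Hf Hg; apply bigO_plus; [exact Hf|apply bigO_opp, Hg]. Qed.

Lemma bigO_weaken (m k : nat) f : bigO Om m (S k) f -> bigO Om m k f.
Proof.
assert (Hb : forall f, bounded_by Om (S k) f -> bounded_by Om k f).
{ intros f0 [C HC]; exists (Rabs C); revert HC; apply ev_imp.
  intros e t x He _ Hf; eapply Rle_trans; [exact Hf|].
  assert (Hek : 0 < e ^ k) by (apply pow_lt; lra).
  simpl; rewrite (Rmult_comm e), <- Rmult_assoc.
  pose proof (Rle_abs C); pose proof (Rabs_pos C).
  assert (Hc : C * e ^ k <= Rabs C * e ^ k) by (apply Rmult_le_compat_r; lra).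
  assert (Hp : 0 <= Rabs C * e ^ k) by (apply Rmult_le_pos; lra).
  nra. }
revert f; induction m as [|m IH]; intros f Hf.
- split; [apply Hb; exact (proj1 Hf)|exact I].
- destruct Hf as [H1 [H2 [H3 H4]]]; split; [apply Hb, H1|].
  split; [exact H2|split; apply IH; assumption].
Qed.

Lemma bigO_div_e (m k : nat) f :
  bigO Om m (S k) f -> bigO Om m k (fun e t x => f e t x / e).
Proof.
assert (Hb : forall f, bounded_by Om (S k) f ->
  bounded_by Om k (fun e t x => f e t x / e)).
{ intros f0 [C HC]; exists C; revert HC; apply ev_imp.
  intros e t x He _ Hf; unfold Rdiv; rewrite Rabs_mult, Rabs_inv, (Rabs_pos_eq e) by lra.
  apply Rle_div_l; [lra|]; simpl in Hf; lra. }
revert f; induction m as [|m IH]; intros f Hf.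
- split; [apply Hb; exact (proj1 Hf)|exact I].
- eapply bigO_S_intro.
  + apply Hb, (bigO_bounded _ _ _ Hf).
  + generalize (bigO_is_derive _ _ _ Hf); apply ev_imp.
    intros e t x _ _ [H1 H2]; split.
    * apply (is_derive_ext (fun s => / e * f e s x)); [intros s; apply Rmult_comm|].
      exact (is_derive_scal _ _ (/ e) _ H1).
    * apply (is_derive_ext (fun y => / e * f e t y)); [intros y; apply Rmult_comm|].
      exact (is_derive_scal _ _ (/ e) _ H2).
  + apply (bigO_ext m k (fun e t x => dt (f e) t x / e)).
    * apply ev_forall; intros e t x _ _; unfold Rdiv; apply Rmult_comm.
    * apply (IH (fun e => dt (f e))), bigO_dt, Hf.
  + apply (bigO_ext m k (fun e t x => dx (f e) t x / e)).
    * apply ev_forall; intros e t x _ _; unfold Rdiv; apply Rmult_comm.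
    * apply (IH (fun e => dx (f e))), bigO_dx, Hf.
Qed.

(** The derivatives of [/ f] are products of derivatives of [f] with [/ f]
    itself, so the induction closes without higher derivatives of the inverse. *)
Lemma bigO_inv (m : nat) f (c : R) : 0 < c ->
  eventually_on Om (fun e t x => c <= f e t x) ->
  bigO Om m 0 f -> bigO Om m 0 (fun e t x => / f e t x).
Proof.
intros Hc Hcf.
assert (Hb : bounded_by Om 0 (fun e t x => / f e t x)).
{ exists (/ c); revert Hcf; apply ev_imp; intros e t x _ _ H; simpl.
  assert (0 < / f e t x) by (apply Rinv_0_lt_compat; lra).
  rewrite Rabs_pos_eq, Rmult_1_r by lra; apply Rinv_le_contravar; lra. }
induction m as [|m IH]; intros Hf; [split; [exact Hb|exact I]|].
assert (Hg := IH (bigO_pred _ _ _ Hf)).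
eapply (bigO_S_intro _ _ _
  (fun e t x => - dt (f e) t x * (/ f e t x * / f e t x))
  (fun e t x => - dx (f e) t x * (/ f e t x * / f e t x))).
- exact Hb.
- generalize (ev_and _ _ Hcf (bigO_is_derive _ _ _ Hf)); apply ev_imp.
  intros e t x _ _ [H [H1 H2]]; split.
  + replace (- dt (f e) t x * (/ f e t x * / f e t x))
      with (- dt (f e) t x / f e t x ^ 2) by (field; lra).
    apply (is_derive_inv _ _ _ H1); lra.
  + replace (- dx (f e) t x * (/ f e t x * / f e t x))
      with (- dx (f e) t x / f e t x ^ 2) by (field; lra).
    apply (is_derive_inv _ _ _ H2); lra.
- apply (bigO_mult m 0 0); [apply bigO_opp, bigO_dt, Hf|].
  exact (bigO_mult m 0 0 _ _ Hg Hg).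
- apply (bigO_mult m 0 0); [apply bigO_opp, bigO_dx, Hf|].
  exact (bigO_mult m 0 0 _ _ Hg Hg).
Qed.

End BigO.

(** * Smooth functions of a field *)

Lemma class_C_ex_derive (D : R -> Prop) (m : nat) g y :
  class_C D (S m) g -> D y -> ex_derive g y.
Proof. intros Hg Hy; exact (proj1 (Hg y Hy) 1%nat (le_n_S _ _ (Nat.le_0_l m))). Qed.

Lemma class_C_continuous (D : R -> Prop) (m : nat) g y :
  class_C D m g -> D y -> continuous g y.
Proof.
destruct m as [|m]; intros Hg Hy; [exact (proj2 (Hg y Hy))|].
apply @ex_derive_continuous, (class_C_ex_derive D m); assumption.
Qed.

Lemma class_C_Derive (D : R -> Prop) (m : nat) g :
  class_C D (S m) g -> class_C D m (Derive g).
Proof.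
assert (Hk : forall k y, Derive_n (Derive g) k y = Derive_n g (S k) y).
{ intros k y; rewrite <- (Nat.add_1_r k), <- Derive_n_comp; reflexivity. }
intros Hg y Hy; destruct (Hg y Hy) as [H1 H2]; split.
- intros [|k] Hkm; [exact I|].
  apply (ex_derive_ext (Derive_n g (S k))); [intros s; symmetry; apply Hk|].
  apply (H1 (S (S k))); lia.
- apply (continuous_ext (Derive_n g (S m))); [intros s; symmetry; apply Hk|].
  exact H2.
Qed.

Lemma class_C_pred (D : R -> Prop) (m : nat) g : class_C D (S m) g -> class_C D m g.
Proof.
intros Hg y Hy; destruct (Hg y Hy) as [H1 _]; split.
- intros k Hk; apply H1; lia.
- apply @ex_derive_continuous; exact (H1 (S m) (le_n _)).
Qed.

Lemma class_C_le (D : R -> Prop) (m n : nat) g :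
  (m <= n)%nat -> class_C D n g -> class_C D m g.
Proof. induction 1; auto using class_C_pred. Qed.

Lemma continuous_bounded (g : R -> R) (c d : R) :
  (forall y, c <= y <= d -> continuous g y) ->
  exists B, forall y, c <= y <= d -> Rabs (g y) <= B.
Proof.
intros Hg; destruct (Rle_dec c d) as [Hcd|Hcd]; [|exists 0; intros; lra].
destruct (continuity_ab_maj (fun y => Rabs (g y)) c d Hcd) as [Mx [HM _]].
- intros y Hy; apply continuity_pt_filterlim.
  apply (continuous_comp g Rabs); [apply Hg, Hy|apply continuous_Rabs].
- exists (Rabs (g Mx)); exact HM.
Qed.

Lemma dt_minus (f g : R -> R -> R) (t x : R) :
  ex_derive (fun s => f s x) t -> ex_derive (fun s => g s x) t ->
  dt (fun t x => f t x - g t x) t x = dt f t x - dt g t x.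
Proof. intros Hf Hg; exact (Derive_minus _ _ _ Hf Hg). Qed.

Lemma dx_minus (f g : R -> R -> R) (t x : R) :
  ex_derive (fun y => f t y) x -> ex_derive (fun y => g t y) x ->
  dx (fun t x => f t x - g t x) t x = dx f t x - dx g t x.
Proof. intros Hf Hg; exact (Derive_minus _ _ _ Hf Hg). Qed.

Lemma dx_mult (f g : R -> R -> R) (t x : R) :
  ex_derive (fun y => f t y) x -> ex_derive (fun y => g t y) x ->
  dx (fun t x => f t x * g t x) t x = dx f t x * g t x + f t x * dx g t x.
Proof. intros Hf Hg; exact (Derive_mult _ _ _ Hf Hg). Qed.

Section Composition.
Context (J : R -> Prop) (c d : R) (J_range : forall y, c <= y <= d -> J y).

Lemma mean_value g (y1 y2 : R) : class_C J 1 g ->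
  c <= y1 <= d -> c <= y2 <= d ->
  exists y, (c <= y <= d /\ Rabs (y - y1) <= Rabs (y2 - y1)) /\
            g y2 - g y1 = Derive g y * (y2 - y1).
Proof.
intros Hg H1 H2.
assert (Hr : forall y, Rmin y1 y2 <= y <= Rmax y1 y2 -> J y /\
   c <= y <= d /\ Rabs (y - y1) <= Rabs (y2 - y1)).
{ intros y; unfold Rmin, Rmax; destruct (Rle_dec y1 y2); intros Hy;
    (split; [apply J_range; lra|split; [lra|]]).
  - rewrite 2!Rabs_pos_eq; lra.
  - rewrite 2!Rabs_left1; lra. }
destruct (MVT_gen g y1 y2 (Derive g)) as [y [Hy Heq]].
- intros y Hy; apply Derive_correct, (class_C_ex_derive J 0); [exact Hg|].
  apply Hr; lra.
- intros y Hy; apply continuity_pt_filterlim, (class_C_continuous J 1); [exact Hg|].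
  apply Hr, Hy.
- exists y; split; [apply Hr, Hy|exact Heq].
Qed.

Lemma increment_bound g : class_C J 1 g ->
  exists L, 0 <= L /\ forall y1 y2, c <= y1 <= d -> c <= y2 <= d ->
    Rabs (g y2 - g y1) <= L * Rabs (y2 - y1).
Proof.
intros Hg; destruct (continuous_bounded (Derive g) c d) as [B HB].
{ intros y Hy; apply (class_C_continuous J 0);
    [apply class_C_Derive, Hg|apply J_range, Hy]. }
exists (Rabs B); split; [apply Rabs_pos|]; intros y1 y2 H1 H2.
destruct (mean_value g y1 y2 Hg H1 H2) as [y [[Hy _] ->]].
rewrite Rabs_mult; apply Rmult_le_compat_r; [apply Rabs_pos|].
eapply Rle_trans; [apply HB, Hy|apply Rle_abs].
Qed.

(** A quadratic bound from the mean value theorem alone: the remainder is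
    [(g' y - g' y1) (y2 - y1)] at an intermediate [y], and [g'] is Lipschitz. *)
Lemma taylor_bound g : class_C J 2 g ->
  exists L, 0 <= L /\ forall y1 y2, c <= y1 <= d -> c <= y2 <= d ->
    Rabs (g y2 - g y1 - Derive g y1 * (y2 - y1)) <= L * (Rabs (y2 - y1) * Rabs (y2 - y1)).
Proof.
intros Hg; destruct (increment_bound (Derive g)) as [L [HL HB]].
{ apply class_C_Derive, Hg. }
exists L; split; [exact HL|]; intros y1 y2 H1 H2.
destruct (mean_value g y1 y2 (class_C_pred _ _ _ Hg) H1 H2) as [y [[Hy Hd] ->]].
rewrite <- Rmult_minus_distr_r, Rabs_mult, <- Rmult_assoc.
apply Rmult_le_compat_r; [apply Rabs_pos|].
eapply Rle_trans; [apply HB; assumption|].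
apply Rmult_le_compat_l; assumption.
Qed.

Context (Om : R * R -> Prop) (Om_open : open Om).
Context (u : R -> R -> R -> R).
Context (u_range : eventually_on Om (fun e t x => c <= u e t x <= d)).

Lemma is_derive_Rcomp (g f : R -> R) (x df : R) :
  ex_derive g (f x) -> is_derive f x df ->
  is_derive (fun y => g (f y)) x (Derive g (f x) * df).
Proof.
intros Hg Hf; rewrite Rmult_comm.
exact (is_derive_comp g f x _ _ (Derive_correct _ _ Hg) Hf).
Qed.

Lemma bigO_comp_is_derive (m k : nat) g : class_C J (S m) g -> bigO Om (S m) k u ->
  eventually_on Om (fun e t x =>
    is_derive (fun s => g (u e s x)) t (Derive g (u e t x) * dt (u e) t x) /\
    is_derive (fun y => g (u e t y)) x (Derive g (u e t x) * dx (u e) t x)).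
Proof.
intros Hg Hu.
generalize (ev_and _ _ _ u_range (bigO_is_derive _ _ _ _ Hu)); apply ev_imp.
intros e t x _ _ [Hr [H1 H2]].
assert (Hd : ex_derive g (u e t x)) by (apply (class_C_ex_derive J m); auto).
split.
- exact (is_derive_Rcomp g (fun s => u e s x) t _ Hd H1).
- exact (is_derive_Rcomp g (fun y => u e t y) x _ Hd H2).
Qed.

Lemma bigO_comp (m : nat) g : class_C J m g -> bigO Om m 0 u ->
  bigO Om m 0 (fun e t x => g (u e t x)).
Proof.
revert g; induction m as [|m IH]; intros g Hg Hu;
  (assert (Hb : bounded_by Om 0 (fun e t x => g (u e t x)));
    [destruct (continuous_bounded g c d) as [B HB];
      [intros y Hy; eapply class_C_continuous; eauto|];
     exists B; revert u_range; apply ev_imp; intros e t x _ _ Hr;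
     rewrite Rmult_1_r; apply HB, Hr|]).
- split; [exact Hb|exact I].
- eapply bigO_S_intro; [exact Om_open|exact Hb| | |].
  + apply (bigO_comp_is_derive m 0); assumption.
  + apply (bigO_mult Om Om_open m 0 0); [|apply bigO_dt, Hu].
    apply IH; [apply class_C_Derive, Hg|apply bigO_pred, Hu].
  + apply (bigO_mult Om Om_open m 0 0); [|apply bigO_dx, Hu].
    apply IH; [apply class_C_Derive, Hg|apply bigO_pred, Hu].
Qed.

End Composition.

Section Increments.
Context (J : R -> Prop) (c d : R) (J_range : forall y, c <= y <= d -> J y).
Context (Om : R * R -> Prop) (Om_open : open Om).
Context (u u' : R -> R -> R -> R).
Context (u_range : eventually_on Om (fun e t x => c <= u e t x <= d)).
Context (u'_range : eventually_on Om (fun e t x => c <= u' e t x <= d)).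

(** With [h = u' - u], the derivative of [g u' - g u] is
    [(g' u' - g' u) Du + g' u' Dh]: an increment of [g'], and a factor [Dh]
    which is itself small. *)
Lemma bigO_increment (m k : nat) g : class_C J (S m) g ->
  bigO Om m 0 u -> bigO Om m 0 u' ->
  bigO Om m k (fun e t x => u' e t x - u e t x) ->
  bigO Om m k (fun e t x => g (u' e t x) - g (u e t x)).
Proof.
revert g; induction m as [|m IH]; intros g Hg Hu Hu' Hh;
  (assert (Hb : bounded_by Om k (fun e t x => g (u' e t x) - g (u e t x)));
    [destruct (increment_bound J c d J_range g) as [L [HL HB]];
       [eapply class_C_le; [|exact Hg]; lia|];
     destruct (bigO_bounded _ _ _ _ Hh) as [C HC]; exists (L * C);
     generalize (ev_and _ _ _ HC (ev_and _ _ _ u_range u'_range)); apply ev_imp;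
     intros e t x _ _ [H [H1 H2]];
     eapply Rle_trans; [apply HB; assumption|];
     rewrite Rmult_assoc; apply Rmult_le_compat_l; assumption|]).
- split; [exact Hb|exact I].
- assert (Hh0 := IH _ (class_C_Derive _ _ _ Hg)
    (bigO_pred _ _ _ _ Hu) (bigO_pred _ _ _ _ Hu') (bigO_pred _ _ _ _ Hh)).
  assert (Hg' : bigO Om m 0 (fun e t x => Derive g (u' e t x))).
  { apply (bigO_comp J c d J_range); auto using bigO_pred.
    apply class_C_pred, class_C_Derive, Hg. }
  assert (Hd : eventually_on Om (fun e t x =>
    is_derive (fun s => g (u' e s x) - g (u e s x)) t
      ((Derive g (u' e t x) - Derive g (u e t x)) * dt (u e) t x
       + Derive g (u' e t x) * dt (fun t x => u' e t x - u e t x) t x) /\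
    is_derive (fun y => g (u' e t y) - g (u e t y)) x
      ((Derive g (u' e t x) - Derive g (u e t x)) * dx (u e) t x
       + Derive g (u' e t x) * dx (fun t x => u' e t x - u e t x) t x))).
  { generalize (ev_and _ _ _
      (ev_and _ _ _ (bigO_partials _ _ _ _ Hu) (bigO_partials _ _ _ _ Hu'))
      (ev_and _ _ _
        (bigO_comp_is_derive J c d J_range Om u u_range _ _ g (class_C_pred _ _ _ Hg) Hu)
        (bigO_comp_is_derive J c d J_range Om u' u'_range _ _ g (class_C_pred _ _ _ Hg) Hu'))).
    apply ev_imp; intros e t x _ _ [[[Ht Hx] [Ht' Hx']] [[Gt Gx] [Gt' Gx']]]; split.
    - rewrite dt_minus by assumption.
      evar_last; [exact (is_derive_minus _ _ _ _ _ Gt' Gt)|].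
      unfold minus, plus, opp; simpl; ring.
    - rewrite dx_minus by assumption.
      evar_last; [exact (is_derive_minus _ _ _ _ _ Gx' Gx)|].
      unfold minus, plus, opp; simpl; ring. }
  eapply bigO_S_intro; [exact Om_open|exact Hb|exact Hd| |].
  + apply (bigO_plus Om Om_open).
    * rewrite <- (Nat.add_0_r k).
      apply (bigO_mult Om Om_open m k 0); [exact Hh0|apply bigO_dt, Hu].
    * apply (bigO_mult Om Om_open m 0 k); [exact Hg'|exact (bigO_dt _ _ _ _ Hh)].
  + apply (bigO_plus Om Om_open).
    * rewrite <- (Nat.add_0_r k).
      apply (bigO_mult Om Om_open m k 0); [exact Hh0|apply bigO_dx, Hu].
    * apply (bigO_mult Om Om_open m 0 k); [exact Hg'|exact (bigO_dx _ _ _ _ Hh)].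
Qed.

(** With [h = u' - u], the derivative of [g u' - g u - g' u h] is
    [(g' u' - g' u - g'' u h) Du + (g' u' - g' u) Dh]: the same remainder for
    [g'], and a product of two terms of size [e^k]. *)
Lemma bigO_taylor (m k : nat) g : class_C J (S (S m)) g ->
  bigO Om m 0 u -> bigO Om m 0 u' ->
  bigO Om m k (fun e t x => u' e t x - u e t x) ->
  bigO Om m (k + k) (fun e t x =>
    g (u' e t x) - g (u e t x) - Derive g (u e t x) * (u' e t x - u e t x)).
Proof.
revert g; induction m as [|m IH]; intros g Hg Hu Hu' Hh;
  (assert (Hb : bounded_by Om (k + k) (fun e t x =>
      g (u' e t x) - g (u e t x) - Derive g (u e t x) * (u' e t x - u e t x)));
    [destruct (taylor_bound J c d J_range g) as [L [HL HB]];
       [eapply class_C_le; [|exact Hg]; lia|];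
     destruct (bigO_bounded _ _ _ _ Hh) as [C HC]; exists (L * (C * C));
     generalize (ev_and _ _ _ HC (ev_and _ _ _ u_range u'_range)); apply ev_imp;
     intros e t x _ _ [H [H1 H2]];
     eapply Rle_trans; [apply HB; assumption|];
     rewrite Rmult_assoc; apply Rmult_le_compat_l; [exact HL|];
     replace (C * C * e ^ (k + k)) with ((C * e ^ k) * (C * e ^ k))
       by (rewrite pow_add; ring);
     apply Rmult_le_compat; auto using Rabs_pos|]).
- split; [exact Hb|exact I].
- assert (Hg1 := class_C_Derive _ _ _ Hg).
  assert (Hh' := bigO_pred _ _ _ _ Hh).
  assert (HT := IH _ Hg1 (bigO_pred _ _ _ _ Hu) (bigO_pred _ _ _ _ Hu') Hh').
  assert (HI := bigO_increment m k _ (class_C_pred _ _ _ Hg1)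
    (bigO_pred _ _ _ _ Hu) (bigO_pred _ _ _ _ Hu') Hh').
  assert (Hd : eventually_on Om (fun e t x =>
    is_derive (fun s => g (u' e s x) - g (u e s x)
                        - Derive g (u e s x) * (u' e s x - u e s x)) t
      ((Derive g (u' e t x) - Derive g (u e t x)
        - Derive (Derive g) (u e t x) * (u' e t x - u e t x)) * dt (u e) t x
       + (Derive g (u' e t x) - Derive g (u e t x))
         * dt (fun t x => u' e t x - u e t x) t x) /\
    is_derive (fun y => g (u' e t y) - g (u e t y)
                        - Derive g (u e t y) * (u' e t y - u e t y)) x
      ((Derive g (u' e t x) - Derive g (u e t x)
        - Derive (Derive g) (u e t x) * (u' e t x - u e t x)) * dx (u e) t x
       + (Derive g (u' e t x) - Derive g (u e t x))
         * dx (fun t x => u' e t x - u e t x) t x))).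
  { generalize (ev_and _ _ _
      (ev_and _ _ _ (bigO_is_derive _ _ _ _ Hu) (bigO_is_derive _ _ _ _ Hu'))
      (ev_and _ _ _
        (bigO_comp_is_derive J c d J_range Om u u_range _ _ (Derive g)
           (class_C_pred _ _ _ Hg1) Hu)
      (ev_and _ _ _
        (bigO_comp_is_derive J c d J_range Om u u_range _ _ g
           (class_C_pred _ _ _ (class_C_pred _ _ _ Hg)) Hu)
        (bigO_comp_is_derive J c d J_range Om u' u'_range _ _ g
           (class_C_pred _ _ _ (class_C_pred _ _ _ Hg)) Hu')))).
    apply ev_imp.
    intros e t x _ _ [[[Ht Hx] [Ht' Hx']] [[Kt Kx] [[Gt Gx] [Gt' Gx']]]]; split.
    - rewrite dt_minus by (eexists; eassumption).
      evar_last; [exact (is_derive_minus _ _ _ _ _ (is_derive_minus _ _ _ _ _ Gt' Gt)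
        (is_derive_Rmult _ _ _ _ _ Kt (is_derive_minus _ _ _ _ _ Ht' Ht)))|].
      unfold minus, plus, opp; simpl; ring.
    - rewrite dx_minus by (eexists; eassumption).
      evar_last; [exact (is_derive_minus _ _ _ _ _ (is_derive_minus _ _ _ _ _ Gx' Gx)
        (is_derive_Rmult _ _ _ _ _ Kx (is_derive_minus _ _ _ _ _ Hx' Hx)))|].
      unfold minus, plus, opp; simpl; ring. }
  eapply bigO_S_intro; [exact Om_open|exact Hb|exact Hd| |].
  + apply (bigO_plus Om Om_open).
    * rewrite <- (Nat.add_0_r (k + k)).
      apply (bigO_mult Om Om_open m (k + k) 0); [exact HT|apply bigO_dt, Hu].
    * apply (bigO_mult Om Om_open m k k); [exact HI|exact (bigO_dt _ _ _ _ Hh)].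
  + apply (bigO_plus Om Om_open).
    * rewrite <- (Nat.add_0_r (k + k)).
      apply (bigO_mult Om Om_open m (k + k) 0); [exact HT|apply bigO_dx, Hu].
    * apply (bigO_mult Om Om_open m k k); [exact HI|exact (bigO_dx _ _ _ _ Hh)].
Qed.
End Increments.

(** * The Chapman-Enskog expansion *)

Lemma intermediate_value (f : R -> R) (a b y : R) :
  (forall r, Rmin a b <= r <= Rmax a b -> continuous f r) ->
  f a <= y <= f b -> exists r, Rmin a b <= r <= Rmax a b /\ f r = y.
Proof.
intros Hf Hy; destruct (Rtotal_order a b) as [Hab|[Hab|Hab]].
- rewrite Rmin_left, Rmax_right in * by lra.
  destruct (f_interv_is_interv f a b y Hab Hy) as [r Hr]; [|exists r; exact Hr].
  intros r Hr; apply continuity_pt_filterlim, Hf, Hr.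
- subst b; exists a; rewrite Rmin_left, Rmax_left by lra; lra.
- rewrite Rmin_right, Rmax_left in * by lra.
  destruct (f_interv_is_interv (fun r => - f r) b a (- y) Hab) as [r [Hr Heq]].
  + lra.
  + intros r Hr; apply continuity_pt_opp, continuity_pt_filterlim, Hf, Hr.
  + exists r; split; [exact Hr|lra].
Qed.

(** Room around the equilibrium hesitations: the relaxed hesitation differs from
    [H(rho)] by [O(e)], so it stays in such a thickened interval for small [e],
    where the derivatives of [q] are bounded. *)
Lemma compact_image_thickening (J : R -> Prop) (f : R -> R) (a b : R) :
  open J -> (forall r, a <= r <= b -> continuous f r /\ J (f r)) ->
  exists c d delta, 0 < delta /\
    (forall y, c - delta <= y <= d + delta -> J y) /\
    (forall r, a <= r <= b -> c <= f r <= d).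
Proof.
intros HJ Hf; destruct (Rle_dec a b) as [Hab|Hab].
(* For an empty [a, b], endpoints in the wrong order give an interval that is
   still empty after thickening. *)
2: exists 1, 0, (/ 4); repeat split; intros; lra.
assert (Hc : forall r, a <= r <= b -> continuity_pt f r).
{ intros r Hr; apply continuity_pt_filterlim, Hf, Hr. }
destruct (continuity_ab_min f a b Hab Hc) as [p [Hp Hpab]].
destruct (continuity_ab_maj f a b Hab Hc) as [s [Hs Hsab]].
destruct (HJ _ (proj2 (Hf p Hpab))) as [d1 H1].
destruct (HJ _ (proj2 (Hf s Hsab))) as [d2 H2].
pose proof (cond_pos d1); pose proof (cond_pos d2).
exists (f p), (f s), (Rmin d1 d2 / 2).
pose proof (Rmin_l d1 d2); pose proof (Rmin_r d1 d2).
assert (0 < Rmin d1 d2) by (apply Rmin_pos; assumption).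
split; [lra|split; [|intros r Hr; split; auto]].
intros y Hy; destruct (Rlt_dec y (f p)) as [Hyp|Hyp].
{ apply H1; apply Rabs_def1; unfold minus, plus, opp; simpl; lra. }
destruct (Rlt_dec (f s) y) as [Hys|Hys].
{ apply H2; apply Rabs_def1; unfold minus, plus, opp; simpl; lra. }
assert (Hin : forall r, Rmin p s <= r <= Rmax p s -> a <= r <= b).
{ intros r; unfold Rmin, Rmax; destruct (Rle_dec p s); lra. }
destruct (intermediate_value f p s y) as [r [Hr <-]].
- intros r Hr; apply Hf, Hin, Hr.
- lra.
- apply Hf, Hin, Hr.
Qed.

Lemma hesitation_Weq (hb H : R -> R) (r : R) :
  r <> 0 -> hesitation hb r (Weq hb H r) = H r.
Proof. intros Hr; unfold hesitation, Weq; field; exact Hr. Qed.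

Lemma hesitation_sub (hb H : R -> R) (r w : R) :
  r <> 0 -> hesitation hb r w - H r = (w - Weq hb H r) * / r.
Proof. intros Hr; unfold hesitation, Weq; field; exact Hr. Qed.

Lemma is_derive_Weq (hb H : R -> R) (r : R) : ex_derive hb r -> ex_derive H r ->
  is_derive (Weq hb H) r (H r - hb r + r * (Derive H r - Derive hb r)).
Proof.
intros Hhb HH; evar_last.
- exact (is_derive_Rmult _ _ _ _ _ (is_derive_id r)
    (is_derive_minus _ _ _ _ _ (Derive_correct _ _ HH) (Derive_correct _ _ Hhb))).
- unfold one, minus, plus, opp; simpl; ring.
Qed.

Section Expansion.
Context (n : nat) (q hb H : R -> R) (D J : R -> Prop).
Context (D_pos : forall r, D r -> 0 < r).
Context (J_open : open J) (H_in_J : forall r, D r -> J (H r)).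
Context (q_smooth : class_C J (S (S (S n))) q).
Context (hb_smooth : class_C D (S (S n)) hb) (H_smooth : class_C D (S (S n)) H).
Context (Om : R * R -> Prop) (Om_open : open Om) (rho z w w1 : R -> R -> R -> R).
Context (ce : chapman_enskog q hb H D Om (S (S n)) rho z w w1).

Definition v_eq (e t x : R) : R :=
  velocity q hb (rho e t x) (z e t x) (Weq hb H (rho e t x)).
Definition v_rel (e t x : R) : R := velocity q hb (rho e t x) (z e t x) (w e t x).
Definition slip (e t x : R) : R := v_eq e t x - v_rel e t x.
Definition deviation (e t x : R) : R := w e t x - Weq hb H (rho e t x).

Local Notation bigO_add := (bigO_plus Om Om_open).
Local Notation bigO_sub := (bigO_minus Om Om_open).
Local Notation bigO_mul := (bigO_mult Om Om_open).

Lemma density_in_D : eventually_on Om (fun e t x => D (rho e t x)).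
Proof.
destruct (ce_rho_range _ _ _ _ _ _ _ _ _ _ ce) as [a [b [Hab Hr]]].
revert Hr; apply ev_imp; auto.
Qed.

Lemma density_pos : eventually_on Om (fun e t x => 0 < rho e t x).
Proof. generalize density_in_D; apply ev_imp; auto. Qed.

Lemma bigO_density_comp (m : nat) g : (m <= S (S n))%nat -> class_C D m g ->
  bigO Om m 0 (fun e t x => g (rho e t x)).
Proof.
intros Hm Hg; destruct (ce_rho_range _ _ _ _ _ _ _ _ _ _ ce) as [a [b [Hab Hr]]].
apply (bigO_comp D a b Hab); auto.
apply (bigO_le _ _ _ _ _ Hm), (ce_rho _ _ _ _ _ _ _ _ _ _ ce).
Qed.

Lemma bigO_inv_density : bigO Om (S (S n)) 0 (fun e t x => / rho e t x).
Proof.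
destruct (ce_rho_range _ _ _ _ _ _ _ _ _ _ ce) as [a [b [Hab Hr]]].
assert (Hc : exists c, 0 < c /\ eventually_on Om (fun e t x => c <= rho e t x)).
{ destruct (Rle_dec a b) as [Hle|Hle].
  - exists a; split; [apply D_pos, Hab; lra|].
    revert Hr; apply ev_imp; intros e t x _ _ [Hr _]; exact Hr.
  - exists 1; split; [lra|]; revert Hr; apply ev_imp; intros; lra. }
destruct Hc as [c [Hc Hcr]].
apply (bigO_inv Om Om_open _ _ c Hc Hcr), (ce_rho _ _ _ _ _ _ _ _ _ _ ce).
Qed.

Lemma bigO_deviation : bigO Om (S (S n)) 1 deviation.
Proof.
apply (bigO_ext Om Om_open _ _ (fun e t x =>
  e * w1 e t x + (w e t x - (Weq hb H (rho e t x) + e * w1 e t x)))).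
- apply ev_forall; intros e t x _ _; unfold deviation; ring.
- apply bigO_add.
  + exact (bigO_mul _ 1 0 _ _ (bigO_e Om Om_open _) (ce_w1 _ _ _ _ _ _ _ _ _ _ ce)).
  + apply bigO_weaken, (ce_expansion _ _ _ _ _ _ _ _ _ _ ce).
Qed.

Lemma bigO_Weq : bigO Om (S (S n)) 0 (fun e t x => Weq hb H (rho e t x)).
Proof.
apply (bigO_mul _ 0 0); [apply (ce_rho _ _ _ _ _ _ _ _ _ _ ce)|].
apply bigO_sub; apply bigO_density_comp; auto.
Qed.

Lemma bigO_w : bigO Om (S (S n)) 0 w.
Proof.
apply (bigO_ext Om Om_open _ _ (fun e t x => Weq hb H (rho e t x) + deviation e t x)).
- apply ev_forall; intros e t x _ _; unfold deviation; ring.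
- apply bigO_add; [exact bigO_Weq|apply bigO_weaken, bigO_deviation].
Qed.

(** The relaxed hesitation is [H(rho) + deviation / rho]; the last two bounds
    are the increment and the Taylor remainder of [q] at [H(rho)].  The first two
    concern the coefficients and share the same range argument. *)
Lemma slip_expansion :
  bigO Om (S (S n)) 0 (fun e t x => q (H (rho e t x))) /\
  bigO Om (S n) 0 (fun e t x => Derive q (H (rho e t x))) /\
  bigO Om (S (S n)) 1 slip /\
  bigO Om (S n) 2 (fun e t x =>
    slip e t x - Derive q (H (rho e t x)) * (deviation e t x * / rho e t x)).
Proof.
destruct (ce_rho_range _ _ _ _ _ _ _ _ _ _ ce) as [a [b [Hab Hr]]].
destruct (compact_image_thickening J H a b J_open) as [c [d [delta [Hdelta [HJ HH]]]]].
{ intros r Hrab; split; [|apply H_in_J, Hab, Hrab].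
  apply (class_C_continuous D (S (S n))); auto. }
set (u := fun e t x : R => H (rho e t x)).
set (u' := fun e t x : R => hesitation hb (rho e t x) (w e t x)).
assert (Hu : bigO Om (S (S n)) 0 u) by (apply bigO_density_comp; auto).
assert (Hdev : bigO Om (S (S n)) 1 (fun e t x => deviation e t x * / rho e t x)).
{ exact (bigO_mul _ 1 0 _ _ bigO_deviation bigO_inv_density). }
assert (Heq : eventually_on Om (fun e t x =>
  deviation e t x * / rho e t x = u' e t x - u e t x)).
{ generalize density_pos; apply ev_imp; intros e t x _ _ Hp.
  symmetry; apply (hesitation_sub hb H); lra. }
assert (Hh := bigO_ext Om Om_open _ _ _ _ Heq Hdev).
assert (Hu' : bigO Om (S (S n)) 0 u').
{ apply (bigO_ext Om Om_open _ _ (fun e t x => u e t x + (u' e t x - u e t x))).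
  - apply ev_forall; intros; ring.
  - apply bigO_add; [exact Hu|apply bigO_weaken, Hh]. }
assert (Ru : eventually_on Om (fun e t x => c - delta <= u e t x <= d + delta)).
{ revert Hr; apply ev_imp; intros e t x _ _ Hrx.
  specialize (HH _ Hrx); unfold u; lra. }
assert (Ru' : eventually_on Om (fun e t x => c - delta <= u' e t x <= d + delta)).
{ destruct (bigO_bounded _ _ _ _ Hh) as [C HC].
  assert (He : eventually_on Om (fun e _ _ => e * (Rabs C + 1) < delta)).
  { assert (HC0 := Rabs_pos C).
    assert (Hq : 0 < delta / (Rabs C + 1)) by (apply Rdiv_lt_0_compat; lra).
    unfold eventually_on; generalize (at_right_0_lt _ Hq); apply filter_imp; intros e He t x _.
    apply Rlt_div_r; lra. }
  generalize (ev_and _ _ _ He (ev_and _ _ _ HC Hr)); apply ev_imp.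
  intros e t x He0 _ [He1 [HCe Hrx]]; specialize (HH _ Hrx).
  change (H (rho e t x)) with (u e t x) in HH.
  assert (Habs : Rabs (u' e t x - u e t x) <= delta).
  { eapply Rle_trans; [exact HCe|]; pose proof (Rle_abs C); simpl; nra. }
  apply Rabs_le_between in Habs; lra. }
assert (Hslip : eventually_on Om (fun e t x => q (u' e t x) - q (u e t x) = slip e t x)).
{ generalize density_pos; apply ev_imp; intros e t x _ _ Hp.
  unfold slip, v_eq, v_rel, velocity; rewrite hesitation_Weq by lra.
  unfold u, u'; ring. }
split; [|split; [|split]].
- apply (bigO_comp J _ _ HJ Om Om_open u Ru); [apply class_C_pred, q_smooth|exact Hu].
- apply (bigO_comp J _ _ HJ Om Om_open u Ru); [|apply bigO_pred, Hu].
  apply class_C_pred, class_C_Derive, q_smooth.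
- apply (bigO_ext Om Om_open _ _ _ _ Hslip).
  apply (bigO_increment J _ _ HJ Om Om_open u u' Ru Ru'); assumption.
- apply (bigO_ext Om Om_open _ _ (fun e t x =>
    q (u' e t x) - q (u e t x) - Derive q (u e t x) * (u' e t x - u e t x))).
  + generalize (ev_and _ _ _ Heq Hslip); apply ev_imp.
    intros e t x _ _ [-> ->]; reflexivity.
  + apply (bigO_taylor J _ _ HJ Om Om_open u u' Ru Ru' (S n) 1);
      auto using bigO_pred.
Qed.

Lemma bigO_v_eq : bigO Om (S (S n)) 0 v_eq.
Proof.
apply (bigO_ext Om Om_open _ _ (fun e t x =>
  z e t x * / rho e t x - q (H (rho e t x)))).
- generalize density_pos; apply ev_imp; intros e t x _ _ Hp.
  unfold v_eq, velocity; rewrite hesitation_Weq by lra; reflexivity.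
- apply bigO_sub; [|apply slip_expansion].
  apply (bigO_mul _ 0 0); [apply (ce_z _ _ _ _ _ _ _ _ _ _ ce)|apply bigO_inv_density].
Qed.

Lemma bigO_v_rel : bigO Om (S (S n)) 0 v_rel.
Proof.
apply (bigO_ext Om Om_open _ _ (fun e t x => v_eq e t x - slip e t x)).
- apply ev_forall; intros; unfold slip; ring.
- apply bigO_sub; [exact bigO_v_eq|apply bigO_weaken, slip_expansion].
Qed.

(** Solving the relaxation equation for [w1] and eliminating [dt rho] by the
    density equation turns this difference, exactly, into the transport of the
    deviation, the [slip] and the remainder divided by [e]; every piece carries
    a factor [e]. *)
Lemma bigO_first_corrector : bigO Om (S n) 1 (fun e t x =>
  w1 e t x - rho e t x ^ 2 * (Derive hb (rho e t x) - Derive H (rho e t x))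
             * dx (v_eq e) t x).
Proof.
destruct slip_expansion as [_ [_ [Hslip _]]].
assert (HR := ce_expansion _ _ _ _ _ _ _ _ _ _ ce).
assert (Hrho := ce_rho _ _ _ _ _ _ _ _ _ _ ce).
apply (bigO_ext Om Om_open _ _ (fun e t x =>
  dt (deviation e) t x + dx (deviation e) t x * v_rel e t x
  + deviation e t x * dx (v_rel e) t x
  - rho e t x * rho e t x * (Derive hb (rho e t x) - Derive H (rho e t x))
    * dx (slip e) t x
  - (w e t x - (Weq hb H (rho e t x) + e * w1 e t x)) / e)).
- generalize (ev_and _ _ _ density_in_D (ev_and _ _ _ (ce_model _ _ _ _ _ _ _ _ _ _ ce)
    (ev_and _ _ _ (bigO_is_derive _ _ _ _ Hrho)
    (ev_and _ _ _ (bigO_partials _ _ _ _ bigO_w)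
    (ev_and _ _ _ (bigO_partials _ _ _ _ bigO_v_eq)
    (bigO_partials _ _ _ _ bigO_v_rel)))))).
  apply ev_imp.
  intros e t x He _ [HD [[Mr [_ Mw]] [[Rt Rx] [[Wt Wx] [[_ Vx] [_ Ux]]]]]].
  assert (HW := is_derive_Weq hb H (rho e t x)
    (class_C_ex_derive _ _ _ _ hb_smooth HD) (class_C_ex_derive _ _ _ _ H_smooth HD)).
  assert (HWt := is_derive_comp (Weq hb H) (fun s => rho e s x) t _ _ HW Rt).
  assert (HWx := is_derive_comp (Weq hb H) (fun y => rho e t y) x _ _ HW Rx).
  unfold deviation at 1 2.
  rewrite dt_minus, dx_minus; try assumption; try (eexists; eassumption).
  unfold slip; rewrite dx_minus by assumption.
  assert (EWt : dt (fun t x => Weq hb H (rho e t x)) t x = _)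
    by exact (is_derive_unique _ _ _ HWt).
  assert (EWx : dx (fun t x => Weq hb H (rho e t x)) t x = _)
    by exact (is_derive_unique _ _ _ HWx).
  rewrite EWt, EWx.
  change (fun t x => rho e t x * velocity q hb (rho e t x) (z e t x) (w e t x))
    with (fun t x => rho e t x * v_rel e t x) in Mr.
  change (fun t x => w e t x * velocity q hb (rho e t x) (z e t x) (w e t x))
    with (fun t x => w e t x * v_rel e t x) in Mw.
  rewrite dx_mult in Mr; [|eexists; exact Rx|exact Ux].
  rewrite dx_mult in Mw by assumption.
  (* What remains is linear in the time derivatives: solve the two equations
     for them and compare coefficients. *)
  assert (Er : dt (rho e) t x
    = - (dx (rho e) t x * v_rel e t x + rho e t x * dx (v_rel e) t x)) by lra.
  assert (Ew : dt (w e) t x = - ((Weq hb H (rho e t x) - w e t x) / e)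
    - (dx (w e) t x * v_rel e t x + w e t x * dx (v_rel e) t x)) by lra.
  rewrite Ew, Er; unfold deviation, scal; simpl; unfold mult; simpl.
  unfold Weq; field; lra.
- assert (Hc : bigO Om (S n) 0 (fun e t x =>
    Derive hb (rho e t x) - Derive H (rho e t x))).
  { apply bigO_sub; apply bigO_density_comp; auto using class_C_Derive. }
  apply bigO_sub; [apply bigO_sub; [apply bigO_add; [apply bigO_add|]|]|].
  + apply bigO_dt, bigO_deviation.
  + apply (bigO_mul _ 1 0); [apply bigO_dx, bigO_deviation|].
    apply bigO_pred, bigO_v_rel.
  + apply (bigO_mul _ 1 0); [apply bigO_pred, bigO_deviation|].
    apply bigO_dx, bigO_v_rel.
  + apply (bigO_mul _ 0 1); [|apply bigO_dx, Hslip].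
    apply (bigO_mul _ 0 0); [|exact Hc].
    apply (bigO_mul _ 0 0); apply bigO_pred, Hrho.
  + apply (bigO_div_e Om Om_open), bigO_pred, HR.
Qed.

(** The diffusion coefficient emerges here:
    [q'(H) / rho * (e w1)] becomes [e q'(H) rho (hb' - H') dx v = e mu dx v]. *)
Lemma bigO_slip_minus_diffusion : bigO Om (S n) 2 (fun e t x =>
  slip e t x - e * (mu q hb H (rho e t x) * dx (v_eq e) t x)).
Proof.
destruct slip_expansion as [_ [Hq' [_ HT]]].
apply (bigO_ext Om Om_open _ _ (fun e t x =>
  (slip e t x - Derive q (H (rho e t x)) * (deviation e t x * / rho e t x))
  + Derive q (H (rho e t x)) * (/ rho e t x *
    ((w e t x - (Weq hb H (rho e t x) + e * w1 e t x))
     + e * (w1 e t x - rho e t x ^ 2 *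
            (Derive hb (rho e t x) - Derive H (rho e t x)) * dx (v_eq e) t x))))).
- generalize density_pos; apply ev_imp; intros e t x _ _ Hp.
  unfold deviation, mu; field; lra.
- apply bigO_add; [exact HT|].
  apply (bigO_mul _ 0 2); [exact Hq'|].
  apply (bigO_mul _ 0 2); [apply bigO_pred, bigO_inv_density|].
  apply bigO_add; [apply bigO_pred, (ce_expansion _ _ _ _ _ _ _ _ _ _ ce)|].
  exact (bigO_mul _ 1 1 _ _ (bigO_e Om Om_open _) bigO_first_corrector).
Qed.

(** [F] is the equilibrium flux, which the second equation writes as
    [z^2 / rho - z q(H)] rather than [z v].  Subtracting the conservation law
    leaves the [x]-derivative of [g (slip - e mu dx v)]. *)
Lemma bigO_residual (g : R -> R -> R -> R) (F : R -> R -> R -> R) :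
  bigO Om (S (S n)) 0 g ->
  eventually_on Om (fun e t x =>
    dt (g e) t x + dx (fun t x => g e t x * v_rel e t x) t x = 0) ->
  eventually_on Om (fun e t x => F e t x = g e t x * v_eq e t x) ->
  bigO Om n 2 (fun e t x => dt (g e) t x + dx (F e) t x
    - e * dx (fun t x => g e t x * mu q hb H (rho e t x) * dx (v_eq e) t x) t x).
Proof.
intros Hg Hmodel HF.
assert (Hmu : bigO Om (S n) 0 (fun e t x => mu q hb H (rho e t x))).
{ destruct slip_expansion as [_ [Hq' _]].
  apply (bigO_mul _ 0 0).
  - apply (bigO_mul _ 0 0); [|exact Hq'].
    apply bigO_pred, (ce_rho _ _ _ _ _ _ _ _ _ _ ce).
  - apply bigO_sub; apply bigO_density_comp; auto using class_C_Derive. }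
assert (Hdiff : bigO Om (S n) 0 (fun e t x =>
  g e t x * mu q hb H (rho e t x) * dx (v_eq e) t x)).
{ apply (bigO_mul _ 0 0); [|apply bigO_dx, bigO_v_eq].
  apply (bigO_mul _ 0 0); [apply bigO_pred, Hg|exact Hmu]. }
apply (bigO_ext Om Om_open _ _ (fun e => dx (fun t x =>
  g e t x * (slip e t x - e * (mu q hb H (rho e t x) * dx (v_eq e) t x))))).
- generalize (ev_and _ _ _ HF (ev_and _ _ _ Hmodel
    (ev_and _ _ _ (bigO_partials _ _ _ _ Hdiff)
    (ev_and _ _ _ (bigO_partials _ _ _ _ (bigO_mul _ 0 0 _ _ Hg bigO_v_eq))
    (bigO_partials _ _ _ _ (bigO_mul _ 0 0 _ _ Hg bigO_v_rel)))))).
  apply ev_imp_slice; intros e He Hall t x Htx.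
  rewrite (dx_ext Om Om_open (F e) (fun t x => g e t x * v_eq e t x));
    [|intros t0 x0 H0; apply (Hall t0 x0 H0)|exact Htx].
  destruct (Hall t x Htx) as [_ [Hm [[_ Hd] [[_ Hv] [_ Hu]]]]].
  unfold slip.
  transitivity (dx (fun t x => g e t x * v_eq e t x - g e t x * v_rel e t x
    - e * (g e t x * mu q hb H (rho e t x) * dx (v_eq e) t x)) t x).
  { apply Derive_ext; intros y; ring. }
  rewrite dx_minus; [|apply @ex_derive_minus; assumption|
    apply (ex_derive_scal (fun y => g e t y * mu q hb H (rho e t y) * dx (v_eq e) t y)), Hd].
  rewrite dx_minus by assumption.
  replace (dt (g e) t x) with (- dx (fun t x => g e t x * v_rel e t x) t x) by lra.
  unfold dx at 3; rewrite Derive_scal; fold dx.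
  unfold dx; ring.
- apply bigO_dx, (bigO_mul _ 0 2); [apply bigO_pred, Hg|].
  exact bigO_slip_minus_diffusion.
Qed.

End Expansion.

Theorem theorem4p1 (n : nat) (q hb H : R -> R) (D J : R -> Prop)
  (D_open : open D) (D_pos : forall r, D r -> 0 < r)
  (J_open : open J) (H_in_J : forall r, D r -> J (H r))
  (q_smooth : class_C J (n + 3) q) (q_incr : forall y, J y -> 0 < Derive q y)
  (hb_smooth : class_C D (n + 2) hb) (hb_incr : forall r, D r -> 0 < Derive hb r)
  (H_smooth : class_C D (n + 2) H) :
  (forall (Om : R * R -> Prop) (rho z w w1 : R -> R -> R -> R),
     open Om ->
     chapman_enskog q hb H D Om (n + 2) rho z w w1 ->
     let v := fun e t x =>
       velocity q hb (rho e t x) (z e t x) (Weq hb H (rho e t x)) in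
     bigO Om n 2 (fun e t x =>
       dt (rho e) t x
       + dx (fun t x => rho e t x * v e t x) t x
       - e * dx (fun t x =>
               rho e t x * mu q hb H (rho e t x) * dx (v e) t x) t x) /\
     bigO Om n 2 (fun e t x =>
       dt (z e) t x
       + dx (fun t x => z e t x ^ 2 / rho e t x - z e t x * q (H (rho e t x))) t x
       - e * dx (fun t x =>
               z e t x * mu q hb H (rho e t x) * dx (v e) t x) t x)) /\
  (forall r zz : R, D r -> 0 < zz -> Derive H r < Derive hb r ->
     0 < r * mu q hb H r /\ 0 < zz * mu q hb H r).
Proof.
replace (n + 3)%nat with (S (S (S n))) in q_smooth by lia.
replace (n + 2)%nat with (S (S n)) in * by lia.
split.
- intros Om rho z w w1 Om_open ce v; split.
  + apply (bigO_residual n q hb H D J D_pos J_open H_in_J q_smooth hb_smooth H_smooth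
      Om Om_open rho z w w1 ce rho (fun e t x => rho e t x * v e t x)).
    * apply (ce_rho _ _ _ _ _ _ _ _ _ _ ce).
    * generalize (ce_model _ _ _ _ _ _ _ _ _ _ ce); apply ev_imp_slice.
      intros e _ He t x Htx; apply (He t x Htx).
    * apply ev_forall; reflexivity.
  + apply (bigO_residual n q hb H D J D_pos J_open H_in_J q_smooth hb_smooth H_smooth
      Om Om_open rho z w w1 ce z
      (fun e t x => z e t x ^ 2 / rho e t x - z e t x * q (H (rho e t x)))).
    * apply (ce_z _ _ _ _ _ _ _ _ _ _ ce).
    * generalize (ce_model _ _ _ _ _ _ _ _ _ _ ce); apply ev_imp_slice.
      intros e _ He t x Htx; destruct (He t x Htx) as [_ [Hz _]]; rewrite <- Hz.
      f_equal; apply Derive_ext; intros y; unfold v_rel, velocity, Rdiv; ring.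
    * generalize (density_pos n q hb H D D_pos Om rho z w w1 ce); apply ev_imp.
      intros e t x _ _ Hp; unfold v_eq, velocity; rewrite hesitation_Weq by lra.
      unfold Rdiv; ring.
- intros r zz HD Hzz HH.
  assert (Hmu : 0 < mu q hb H r).
  { unfold mu; apply Rmult_lt_0_compat; [apply Rmult_lt_0_compat|lra].
    - apply D_pos, HD.
    - apply q_incr, H_in_J, HD. }
  split; apply Rmult_lt_0_compat; auto.
Qed.
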